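(* Let $(M,L)$ be a singular Finsler manifold (in the sense of the context) of dimension $n+1$ with $\operatorname{rank}(L_{\mu\nu})=n-D$, and take coordinates with $\det(L_{ab})\neq0$ $(a,b=D+1,\dots,n)$. Using the non-linear Finsler connection with auxiliary functions $G^\mu$ given in the context, the Euler–Lagrange equations of $L$, $$0=\frac{\partial L}{\partial x^\alpha}-d\Big(\frac{\partial L}{\partial dx^\alpha}\Big)=\frac{\partial L}{\partial x^\alpha}-\frac{\partial^2L}{\partial x^\beta\partial dx^\alpha}dx^\beta-\frac{\partial^2L}{\partial dx^\beta\partial dx^\alpha}d^2x^\beta,$$ are equivalent to the auto-parallel equation $$\begin{cases}d^2x^\mu+2G^\mu(x,dx)=\lambda^0\ell_0^\mu+\lambda^I\ell_I^\mu,\\[2pt] \mathcal C_I:=M_I-L_{Ia}L^{ab}M_b=0\qquad(I=1,2,\dots,D),\end{cases}$$ where $\lambda^0,\lambda^I$ are arbitrary functions homogeneous of degree $2$ with respect to $dx^\mu$.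
   Context: $M$ is a differentiable manifold of dimension $n+1$ with local coordinates $(x^\mu)$. Greek indices run over $0,\dots,n$, $I$ over $1,\dots,D$, and $a,b$ over $D+1,\dots,n$; repeated indices are summed. The symbols $dx^\mu$ serve as the fibre coordinates of $TM$. Finsler metric: a function $L(x,dx)$, regular on a sub-bundle $D(L)\subset TM$ depending on $L$, with $L(x,\lambda dx)=\lambda L(x,dx)$ for all $\lambda>0$; no convexity is assumed. Put $p_\mu=\partial L/\partial dx^\mu$ and $L_{\mu\nu}=\partial^2L/\partial dx^\mu\partial dx^\nu$. The rank of $(L_{\mu\nu})$ is at most $n$; $L$ is singular if the rank is less than $n$. Equations on curves: equations containing $dx^\mu$ and $d^2x^\mu$ are equations for an oriented curve in $M$, understood as pulled back by a parameterisation $c(t)$ of the curve, with $c^*dx^\mu=\frac{dx^\mu(t)}{dt}dt$ and $c^*d^2x^\mu=\frac{d^2x^\mu(t)}{dt^2}dt^2$ (pull-back symbols are dropped). Zero eigenvectors: $v_I^\mu(x,dx)$, $I=1,\dots,D$, are independent vectors with $L_{\mu\nu}v_I^\nu=0$ and $p_\mu v_I^\mu=0$. Notation: $\ell_0^\mu=dx^\mu/L$, $\ell_I^\mu=v_I^\mu$, $\ell_a^\mu=L\,\partial\ell_0^\mu/\partial dx^a=\delta_a^\mu-p_a dx^\mu/L$; $(L^{ab})$ is the inverse matrix of $(L_{ab})$; $$M_\mu=\frac12\Big(-\frac{\partial L}{\partial x^\mu}+dx^\rho\frac{\partial^2L}{\partial dx^\mu\partial x^\rho}\Big).$$ Non-linear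 Finsler connection: coefficients ${N^\mu}_\alpha(x,dx)$, homogeneous of degree $1$ in $dx$, with $\partial{N^\mu}_\alpha/\partial dx^\beta=\partial{N^\mu}_\beta/\partial dx^\alpha$ and $\partial L/\partial x^\alpha=p_\mu{N^\mu}_\alpha$; its auxiliary function is $G^\mu=\frac12{N^\mu}_\alpha dx^\alpha$, so that ${N^\mu}_\alpha=\partial G^\mu/\partial dx^\alpha$. The connection is given by $$G^\mu=\frac12\Big(dx^\beta\frac{\partial L}{\partial x^\beta}\Big)\ell_0^\mu+\kappa^I\ell_I^\mu+L^{ab}M_b\,\ell_a^\mu,$$ with $\kappa^I(x,dx)$ arbitrary functions, together with the constraints $M_I=L_{Ia}L^{ab}M_b$. *)

(* Defs.v *)
From HB Require Import structures.
From mathcomp Require Import all_boot all_order all_algebra.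
From mathcomp Require Import all_classical all_reals all_analysis.
Set Implicit Arguments.
Unset Strict Implicit.
Unset Printing Implicit Defensive.
Import Order.TTheory GRing.Theory Num.Theory.
Import numFieldNormedType.Exports.
Local Open Scope classical_set_scope.
Local Open Scope ring_scope.

(* Everything lives in one coordinate chart: a point x and a velocity y (the
   fibre coordinates dx) are row vectors of length n + 1, indexed from 0 to n.
   For a metric whose Hessian has rank n - D, n is written D + m: the rank is m. *)
Notation vec R n := 'rV[R]_n.+1.

Definition idxI (D m : nat) (i : 'I_D) : 'I_(D + m).+1 := lift ord0 (lshift m i).
Definition idxa (D m : nat) (a : 'I_m) : 'I_(D + m).+1 := lift ord0 (rshift D a).

Definition pdx (R : realType) (n : nat) (mu : 'I_n.+1) (F : vec R n -> vec R n -> R)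
    (x y : vec R n) : R :=
  'D_(delta_mx ord0 mu) (fun x' : vec R n => F x' y) x.

Definition pdy (R : realType) (n : nat) (mu : 'I_n.+1) (F : vec R n -> vec R n -> R)
    (x y : vec R n) : R :=
  'D_(delta_mx ord0 mu) (fun y' : vec R n => F x y') y.

(* F is of class C^k on the open set S of the tangent bundle *)
Fixpoint class_C (R : realType) (n k : nat) (S : set (vec R n * vec R n))
    (F : vec R n -> vec R n -> R) : Prop :=
  let F2 := fun z : vec R n * vec R n => F z.1 z.2 in
  match k with
  | 0%N => forall z, S z -> {for z, continuous F2}
  | k'.+1 => (forall z, S z -> differentiable F2 z) /\
      forall mu : 'I_n.+1, class_C k' S (pdx mu F) /\ class_C k' S (pdy mu F)
  end.

Definition homogeneous (R : realType) (n k : nat) (S : set (vec R n * vec R n))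
    (F : vec R n -> vec R n -> R) : Prop :=
  forall (x y : vec R n) (l : R), S (x, y) -> 0 < l -> F x (l *: y) = l ^+ k * F x y.

(* DL is the domain D(L); no convexity of L is required *)
Record finsler_metric (R : realType) (n : nat) (DL : set (vec R n * vec R n))
    (L : vec R n -> vec R n -> R) : Prop := FinslerMetric {
  finsler_open : open DL ;
  finsler_cone : forall (x y : vec R n) (l : R), 0 < l -> DL (x, y) -> DL (x, l *: y) ;
  finsler_regular : class_C 2 DL L ;
  finsler_homogeneous : homogeneous 1 DL L }.

Definition hess (R : realType) (n : nat) (L : vec R n -> vec R n -> R)
    (x y : vec R n) : 'M[R]_n.+1 :=
  \matrix_(mu, nu) pdy mu (pdy nu L) x y.

Definition hess_ab (R : realType) (D m : nat) (L : vec R (D + m) -> vec R (D + m) -> R)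
    (x y : vec R (D + m)) : 'M[R]_m :=
  \matrix_(a, b) hess L x y (idxa D a) (idxa D b).

(* The matrix (L^{ab}) *)
Definition hess_inv (R : realType) (D m : nat) (L : vec R (D + m) -> vec R (D + m) -> R)
    (x y : vec R (D + m)) : 'M[R]_m := invmx (hess_ab L x y).

Record zero_eigenvectors (R : realType) (n D : nat) (DL : set (vec R n * vec R n))
    (L : vec R n -> vec R n -> R) (v : 'I_D -> vec R n -> vec R n -> vec R n) : Prop :=
  ZeroEigenvectors {
  zero_free : forall x y, DL (x, y) -> row_free (\matrix_(i < D) v i x y) ;
  zero_hess : forall x y i mu, DL (x, y) ->
    \sum_(nu < n.+1) hess L x y mu nu * v i x y ord0 nu = 0 ;
  zero_momentum : forall x y i, DL (x, y) ->
    \sum_(mu < n.+1) pdy mu L x y * v i x y ord0 mu = 0 }.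

Definition ell0 (R : realType) (n : nat) (L : vec R n -> vec R n -> R) (x y : vec R n)
    (mu : 'I_n.+1) : R := y ord0 mu / L x y.

Definition ella (R : realType) (D m : nat) (L : vec R (D + m) -> vec R (D + m) -> R)
    (x y : vec R (D + m)) (a : 'I_m) (mu : 'I_(D + m).+1) : R :=
  (mu == idxa D a)%:R - pdy (idxa D a) L x y * y ord0 mu / L x y.

Definition Mcov (R : realType) (n : nat) (L : vec R n -> vec R n -> R) (x y : vec R n)
    (mu : 'I_n.+1) : R :=
  2^-1 * (- pdx mu L x y + \sum_(rho < n.+1) y ord0 rho * pdy mu (pdx rho L) x y).

Definition constraint (R : realType) (D m : nat) (L : vec R (D + m) -> vec R (D + m) -> R)
    (x y : vec R (D + m)) (i : 'I_D) : R :=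
  Mcov L x y (idxI m i) -
  \sum_(a < m) \sum_(b < m)
    hess L x y (idxI m i) (idxa D a) * hess_inv L x y a b * Mcov L x y (idxa D b).

(* N mu alpha is the coefficient N^mu_alpha.  The relation dL/dx = p N is only
   required on a subset S of DL, which for a singular L is the constraint set:
   requiring it on all of DL would force the constraints to hold identically. *)
Record finsler_connection (R : realType) (n : nat) (DL S : set (vec R n * vec R n))
    (L : vec R n -> vec R n -> R) (N : 'I_n.+1 -> 'I_n.+1 -> vec R n -> vec R n -> R) :
    Prop := FinslerConnection {
  connection_homogeneous : forall mu alpha, homogeneous 1 DL (N mu alpha) ;
  connection_differentiable : forall mu alpha x y, DL (x, y) ->
    differentiable (fun y' : vec R n => N mu alpha x y') y ;
  connection_symmetric : forall mu alpha beta x y, DL (x, y) ->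
    pdy beta (N mu alpha) x y = pdy alpha (N mu beta) x y ;
  connection_metric : forall alpha x y, DL (x, y) -> S (x, y) ->
    pdx alpha L x y = \sum_(mu < n.+1) pdy mu L x y * N mu alpha x y }.

Definition auxG (R : realType) (n : nat) (N : 'I_n.+1 -> 'I_n.+1 -> vec R n -> vec R n -> R)
    (x y : vec R n) (mu : 'I_n.+1) : R :=
  2^-1 * \sum_(alpha < n.+1) N mu alpha x y * y ord0 alpha.

Definition explicitG (R : realType) (D m : nat) (L : vec R (D + m) -> vec R (D + m) -> R)
    (v : 'I_D -> vec R (D + m) -> vec R (D + m) -> vec R (D + m))
    (kappa : 'I_D -> vec R (D + m) -> vec R (D + m) -> R)
    (x y : vec R (D + m)) (mu : 'I_(D + m).+1) : R :=
  2^-1 * (\sum_(beta < (D + m).+1) y ord0 beta * pdx beta L x y) * ell0 L x y mu +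
  \sum_(i < D) kappa i x y * v i x y ord0 mu +
  \sum_(a < m) \sum_(b < m)
    hess_inv L x y a b * Mcov L x y (idxa D b) * ella L x y a mu.

(* Parameterised curves over an open interval J; pulling back along c turns dx into
   derive1 c and d^2x into derive1 (derive1 c). *)
Record parameterised_curve (R : realType) (n : nat) (DL : set (vec R n * vec R n))
    (J : set R) (c : R -> vec R n) : Prop := ParameterisedCurve {
  curve_open : open J ;
  curve_interval : is_interval J ;
  curve_derivable : forall t, J t -> derivable c t 1 ;
  curve_derivable2 : forall t, J t -> derivable (derive1 c) t 1 ;
  curve_velocity : forall t, J t -> DL (c t, derive1 c t) }.

Definition el_total (R : realType) (n : nat) (L : vec R n -> vec R n -> R)
    (c : R -> vec R n) (t : R) (alpha : 'I_n.+1) : R :=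
  pdx alpha L (c t) (derive1 c t) - derive1 (fun s : R => pdy alpha L (c s) (derive1 c s)) t.

Definition el_expanded (R : realType) (n : nat) (L : vec R n -> vec R n -> R)
    (c : R -> vec R n) (t : R) (alpha : 'I_n.+1) : R :=
  pdx alpha L (c t) (derive1 c t)
  - \sum_(beta < n.+1) pdx beta (pdy alpha L) (c t) (derive1 c t) * derive1 c t ord0 beta
  - \sum_(beta < n.+1) pdy beta (pdy alpha L) (c t) (derive1 c t) * derive1 (derive1 c) t ord0 beta.

Definition euler_lagrange (R : realType) (n : nat) (L : vec R n -> vec R n -> R)
    (J : set R) (c : R -> vec R n) : Prop :=
  forall t alpha, J t -> 0 = el_total L c t alpha.

Definition auto_parallel (R : realType) (D m : nat)
    (DL : set (vec R (D + m) * vec R (D + m)))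
    (L : vec R (D + m) -> vec R (D + m) -> R)
    (v : 'I_D -> vec R (D + m) -> vec R (D + m) -> vec R (D + m))
    (G : vec R (D + m) -> vec R (D + m) -> 'I_(D + m).+1 -> R)
    (J : set R) (c : R -> vec R (D + m)) : Prop :=
  (exists (lambda0 : vec R (D + m) -> vec R (D + m) -> R)
          (lambda : 'I_D -> vec R (D + m) -> vec R (D + m) -> R),
    [/\ homogeneous 2 DL lambda0,
        (forall i, homogeneous 2 DL (lambda i)) &
        forall t mu, J t ->
          derive1 (derive1 c) t ord0 mu + 2 * G (c t) (derive1 c t) mu =
          lambda0 (c t) (derive1 c t) * ell0 L (c t) (derive1 c t) mu +
          \sum_(i < D) lambda i (c t) (derive1 c t) * v i (c t) (derive1 c t) ord0 mu]) /\
  (forall t i, J t -> constraint L (c t) (derive1 c t) i = 0).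

(* A parameterised curve may return to the same (x, dx) with another acceleration,
   in which case no lambda(x, dx) serves the whole interval although some lambda
   serves a neighbourhood of each parameter value. *)
Definition locally_auto_parallel (R : realType) (D m : nat)
    (DL : set (vec R (D + m) * vec R (D + m)))
    (L : vec R (D + m) -> vec R (D + m) -> R)
    (v : 'I_D -> vec R (D + m) -> vec R (D + m) -> vec R (D + m))
    (G : vec R (D + m) -> vec R (D + m) -> 'I_(D + m).+1 -> R)
    (J : set R) (c : R -> vec R (D + m)) : Prop :=
  forall t0, J t0 -> exists2 e : R, 0 < e &
    auto_parallel DL L v G (J `&` ball t0 e) c.

(* Main.v *)
Require Import Defs.
From HB Require Import structures.
From mathcomp Require Import all_boot all_order all_algebra.
From mathcomp Require Import all_classical all_reals all_analysis.
From mathcomp Require Import ring lra.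
Import Order.TTheory GRing.Theory Num.Theory.
Import numFieldNormedType.Exports.
Local Open Scope classical_set_scope.
Local Open Scope ring_scope.

(* Write H for the Hessian of L in dx.  By symmetry of second derivatives the
   Euler-Lagrange equations read H d^2x = - 2 M, and the kernel of H is spanned by
   dx and the v_I.  The explicit formula for G gives (H G)_a = M_a, and the
   constraint C_I is M_I - (H G)_I.  As H has the rank of its block L_{ab}, the
   equations with index a say that d^2x + 2 G is in the kernel of H, and the
   remaining ones say that H G = M.  For the index 0, which the constraints do not
   mention, H G = M comes from the connection: p.G = dx.(dL/dx) / 2 holds on the
   whole domain, and its derivative in dx turns dL/dx = p N into H G = M.
   The multipliers along a curve extend to homogeneous functions of (x, dx) as soon
   as the curve is injective, which it is locally because its velocity is nonzero. *)

(** * Symmetry of second derivatives *)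

Section Schwarz.
Context {R : realType} {V : normedModType R}.
Implicit Types (f : V -> R) (a u v w z : V).

(** After expanding [(s + h) *: u], the difference quotient of the one-variable restriction is
    literally that of [f] in direction [u]. This brings the one-dimensional mean value theorem to
    bear on [f]. *)
Lemma is_derive_along_line f a u (s : R) : derivable f (a + s *: u) u ->
  is_derive s 1 (fun t : R => f (a + t *: u)) ('D_u f (a + s *: u)).
Proof.
have E : (fun h : R => h^-1 *: (((fun t : R => f (a + t *: u)) \o shift s) (h *: 1)
            - f (a + s *: u)))
       = (fun h : R => h^-1 *: ((f \o shift (a + s *: u)) (h *: u) - f (a + s *: u))).
  apply/funext => h /=.
  by rewrite [h *: 1]mulr1 scalerDl addrCA.
by move=> df; split; rewrite /derivable /derive E.
Qed.

Lemma line_mean_value f a u (h : R) : 0 < h ->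
  (forall s, 0 <= s <= h -> derivable f (a + s *: u) u) ->
  exists2 s, 0 < s < h & f (a + h *: u) - f a = h * 'D_u f (a + s *: u).
Proof.
move=> h0 df.
have [s||s] := @MVT R (fun t => f (a + t *: u)) (fun t => 'D_u f (a + t *: u)) 0 h h0.
- rewrite in_itv /= => /andP[s0 sh].
  by apply: is_derive_along_line; apply: df; rewrite !ltW.
- apply: derivable_within_continuous => s; rewrite in_itv /= => sh.
  by have [] := is_derive_along_line _ _ _ _ (df s sh).
- by rewrite in_itv /= scale0r addr0 subr0 mulrC => sh E; exists s.
Qed.

(* The mean value theorem along u, then along v. *)
Lemma second_difference_approx f z u v (e : R) : 0 < e ->
  (\forall w \near z, derivable f w u) ->
  (\forall w \near z, derivable ('D_u f) w v) ->
  {for z, continuous ('D_v ('D_u f))} ->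
  \forall h \near (0 : R)^'+,
    `|f (z + h *: u + h *: v) - f (z + h *: u) - f (z + h *: v) + f z
      - h ^+ 2 * 'D_v ('D_u f) z| <= e * h ^+ 2.
Proof.
move=> e0 du dvu cvu.
have scaled_close (q a b : R) : 0 < q -> `|a - b| < e -> `|q * b - q * a| <= e * q.
  by move=> q0 ab; rewrite -mulrBr normrM (gtr0_norm q0) [e * _]mulrC ler_pM2l // distrC ltW.
have ce : \forall w \near z, `|'D_v ('D_u f) z - 'D_v ('D_u f) w| < e.
  by move/cvgrPdist_lt : cvu => /(_ e e0).
have [r /= r0 rP] := (nbhs_ballP _ _).1 (filterI (filterI du dvu) ce).
(* The [+ 1] keeps this divisor positive even when [u] and [v] both vanish. *)
have d0 : 0 < `|u| + `|v| + 1 by rewrite ltr_pwDr // addr_ge0.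
have close (h s t : R) : h < r / (`|u| + `|v| + 1) -> 0 <= s <= h -> 0 <= t <= h ->
    ball z r (z + s *: u + t *: v).
  move=> hr /andP[s0 sh] /andP[t0 th].
  rewrite -ball_normE /= -addrA opprD addNKr normrN.
  apply: (le_lt_trans (ler_normD _ _)); rewrite !normrZ !ger0_norm //.
  have : h * (`|u| + `|v| + 1) < r by rewrite -ltr_pdivlMr.
  have h0 : 0 <= h by exact: le_trans s0 sh.
  have := ler_wpM2r (normr_ge0 u) sh.
  have := ler_wpM2r (normr_ge0 v) th.
  rewrite !mulrDr mulr1; lra.
near=> h.
have h0 : 0 < h by near: h; exact: nbhs_right_gt.
have hr : h < r / (`|u| + `|v| + 1).
  by near: h; apply: nbhs_right_lt; apply: divr_gt0.
have h00 : 0 <= h <= h by rewrite lexx ltW.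
have zz : 0 <= (0 : R) <= h by rewrite lexx ltW.
(* The second difference is the increment of [g] along [h *: u]. The derivative of [g] is in turn an
   increment of the [u]-derivative of [f] along [h *: v]. *)
pose g w := f (w + h *: v) - f w.
have dg s : 0 <= s <= h ->
    derivable g (z + s *: u) u /\
    'D_u g (z + s *: u) = 'D_u f (z + s *: u + h *: v) - 'D_u f (z + s *: u).
  move=> sh.
  have d1 : derivable f (z + s *: u) u.
    have := close h s 0 hr sh zz; rewrite scale0r addr0 => /rP [] [] //.
  have d2 : derivable f (z + s *: u + h *: v) u.
    by have /rP [[]] := close h s h hr sh h00.
  have E : (fun k : R => k^-1 *: (((fun w => f (w + h *: v)) \o shift (z + s *: u)) (k *: u)
      - f (z + s *: u + h *: v)))
      = (fun k : R => k^-1 *: ((f \o shift (z + s *: u + h *: v)) (k *: u)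
      - f (z + s *: u + h *: v))).
    by apply/funext => k /=; rewrite !addrA.
  have d3 : is_derive (z + s *: u) u (fun w => f (w + h *: v)) ('D_u f (z + s *: u + h *: v)).
    by split; rewrite /derivable /derive E.
  have [d3a d3b] := d3.
  by split; [exact: derivableB|rewrite deriveB // d3b].
have [s /andP[s0 sh] Es] := line_mean_value g z u h h0 (fun s sh => (dg s sh).1).
have sh' : 0 <= s <= h by rewrite !ltW.
rewrite (dg s sh').2 in Es.
have [t t0|t /andP[t0 th] Et] := line_mean_value ('D_u f) (z + s *: u) v h h0.
  by have /rP [[]] := close h s t hr sh' t0.
rewrite Et /g in Es.
have /rP [_ /= Hst] : ball z r (z + s *: u + t *: v).
  by apply: (close h) => //; rewrite !ltW.
have -> : f (z + h *: u + h *: v) - f (z + h *: u) - f (z + h *: v) + f z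
    = h ^+ 2 * 'D_v ('D_u f) (z + s *: u + t *: v).
  by rewrite expr2 -mulrA -Es; ring.
exact: scaled_close (exprn_gt0 2 h0) Hst.
Unshelve. all: by end_near. Qed.

(** The second difference is symmetric in [u] and [v] and lies within [e / 2 * h ^+ 2] of [h ^+ 2]
    times either mixed derivative, so these differ by at most [e]. The derivatives enter as named
    functions with equations, so that partial derivatives in a chart can be substituted for them. *)
Lemma derive_comm f fu fv fuv fvu z u v :
  'D_u f = fu -> 'D_v f = fv -> 'D_v fu = fuv -> 'D_u fv = fvu ->
  (\forall w \near z, derivable f w u) ->
  (\forall w \near z, derivable f w v) ->
  (\forall w \near z, derivable fu w v) ->
  (\forall w \near z, derivable fv w u) ->
  {for z, continuous fuv} -> {for z, continuous fvu} -> fuv z = fvu z.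
Proof.
move=> <- <- <- <- du dv dvu duv cvu cuv; apply/eqP; rewrite -subr_eq0 -normr_eq0 eq_le normr_ge0 andbT.
apply/ler_addgt0Pl => e e0; rewrite addr0.
have e20 : 0 < e / 2 by rewrite divr_gt0.
have H1 := second_difference_approx f z u v (e / 2) e20 du dvu cvu.
have H2 := second_difference_approx f z v u (e / 2) e20 dv duv cuv.
have [h /= [[{}H1 {}H2] h0]] := filter_ex (filterI (filterI H1 H2) (nbhs_right_gt 0)).
(* Reordering the summands makes both estimates speak of the same four values of [f]. *)
rewrite [z + h *: v + h *: u]addrAC in H2.
have q0 : 0 < h ^+ 2 by rewrite exprn_gt0.
move: ('D_v _ _) ('D_u _ _) (h ^+ 2) q0 H1 H2 => A B q q0.
move: (f _) (f _) (f _) (f _) => X Y Z T H1 H2.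
rewrite -(ler_pM2l q0) -[X in X * `|_|](gtr0_norm q0) -normrM.
by move: H1 H2; rewrite !ler_norml => /andP[? ?] /andP[? ?]; apply/andP; split; lra.
Qed.
End Schwarz.

(** * Partial derivatives on the tangent bundle *)

Section Chart.
Context {R : realType} {n : nat}.
Implicit Types (F : vec R n -> vec R n -> R) (S : set (vec R n * vec R n))
  (x y : vec R n) (z : vec R n * vec R n) (mu nu : 'I_n.+1).

Let e mu : vec R n := delta_mx ord0 mu.

(** Partial derivatives vary one component and freeze the other; read as directional derivatives on
    the product space, they come under the symmetry result, which lives on a single normed space. *)
Lemma pdx_derive mu F :
  (fun z => pdx mu F z.1 z.2) = 'D_(e mu, 0) (fun z => F z.1 z.2).
Proof.
apply/funext => -[x y]; rewrite /pdx /derive.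
set d := (fun _ : R => _); set d' := (fun _ : R => _).
by suff -> : d = d' by []; apply/funext => h; rewrite /d /d' /= scaler0 add0r.
Qed.

Lemma pdy_derive mu F :
  (fun z => pdy mu F z.1 z.2) = 'D_(0, e mu) (fun z => F z.1 z.2).
Proof.
apply/funext => -[x y]; rewrite /pdy /derive.
set d := (fun _ : R => _); set d' := (fun _ : R => _).
by suff -> : d = d' by []; apply/funext => h; rewrite /d /d' /= scaler0 add0r.
Qed.

Lemma near_fibre S x y : open S -> S (x, y) -> \forall y' \near y, S (x, y').
Proof.
move=> oS Sxy; have [[P Q] /= [Px Qy] PQ] : nbhs (x, y) S by exact: open_nbhs_nbhs.
by apply: filterS Qy => y' Qy'; apply: PQ; split => //=; exact: nbhs_singleton Px.
Qed.

Lemma differentiable_fibre F x y :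
  differentiable (fun z => F z.1 z.2) (x, y) -> differentiable (F x) y.
Proof.
move=> dF; have -> : F x = (fun z => F z.1 z.2) \o (fun y' => (x, y')) by [].
by apply: differentiable_comp => //; apply: differentiable_pair.
Qed.

(** Linearity of the differential, applied to the expansion of [(a, b)] in the basis vectors of the
    two factors. *)
Lemma diff_partials F x y (a b : vec R n) :
  differentiable (fun z => F z.1 z.2) (x, y) ->
  'd (fun z => F z.1 z.2) (x, y) (a, b) =
    \sum_mu a ord0 mu * pdx mu F x y + \sum_mu b ord0 mu * pdy mu F x y.
Proof.
move=> dF.
have -> : (a, b) = \sum_mu a ord0 mu *: (e mu, 0 : vec R n)
                 + \sum_mu b ord0 mu *: (0 : vec R n, e mu).
  apply/eqP; rewrite xpair_eqE; apply/andP; split => /=.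
  - rewrite raddf_sum /= raddf_sum /= [X in _ + X]big1 ?addr0; last first.
      by move=> i _; rewrite scaler0.
    by rewrite [X in X == _]row_sum_delta.
  - rewrite raddf_sum /= raddf_sum /= [X in X + _]big1 ?add0r; last first.
      by move=> i _; rewrite scaler0.
    by rewrite [X in X == _]row_sum_delta.
rewrite linearD !linear_sum; congr (_ + _); apply: eq_bigr => mu _;
  rewrite linearZ /= -deriveE //; congr (_ * _).
- by rewrite -(congr1 (@^~ (x, y)) (pdx_derive mu F)).
- by rewrite -(congr1 (@^~ (x, y)) (pdy_derive mu F)).
Qed.

Lemma derive_fibre F x y (w : vec R n) : differentiable (F x) y ->
  'D_w (F x) y = \sum_mu w ord0 mu * pdy mu F x y.
Proof.
move=> dF; rewrite deriveE // [in LHS](row_sum_delta w) linear_sum.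
by apply: eq_bigr => mu _; rewrite linearZ /= -deriveE.
Qed.

Lemma class_C_differentiable k S F z : class_C k.+1 S F -> S z ->
  differentiable (fun z => F z.1 z.2) z.
Proof. by case=> + _; apply. Qed.

Lemma class_C_pdx k S F mu : class_C k.+1 S F -> class_C k S (pdx mu F).
Proof. by case=> _ /(_ mu) []. Qed.

Lemma class_C_pdy k S F mu : class_C k.+1 S F -> class_C k S (pdy mu F).
Proof. by case=> _ /(_ mu) []. Qed.

Section Mixed.
Variables (S : set (vec R n * vec R n)) (F : vec R n -> vec R n -> R).
Hypotheses (oS : open S) (cF : class_C 2 S F).

Let near_derivable k G z (w : vec R n * vec R n) : class_C k.+1 S G -> S z ->
  \forall z' \near z, derivable (fun z => G z.1 z.2) z' w.
Proof.
move=> cG Sz; have : nbhs z S by exact: open_nbhs_nbhs.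
by apply: filterS => z' Sz'; apply: diff_derivable; exact: class_C_differentiable cG Sz'.
Qed.

Lemma pdy_pdyC mu nu z : S z -> pdy mu (pdy nu F) z.1 z.2 = pdy nu (pdy mu F) z.1 z.2.
Proof.
move=> Sz.
have := derive_comm _ _ _ _ _ z _ _ (esym (pdy_derive nu F)) (esym (pdy_derive mu F))
  (esym (pdy_derive mu (pdy nu F))) (esym (pdy_derive nu (pdy mu F))); apply.
- exact: (near_derivable 1).
- exact: (near_derivable 1).
- by apply: (near_derivable 0) => //; exact: class_C_pdy cF.
- by apply: (near_derivable 0) => //; exact: class_C_pdy cF.
- exact: (class_C_pdy 0 S (pdy nu F) mu (class_C_pdy 1 S F nu cF)) z Sz.
- exact: (class_C_pdy 0 S (pdy mu F) nu (class_C_pdy 1 S F mu cF)) z Sz.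
Qed.

Lemma pdx_pdyC mu nu z : S z -> pdx mu (pdy nu F) z.1 z.2 = pdy nu (pdx mu F) z.1 z.2.
Proof.
move=> Sz.
have := derive_comm _ _ _ _ _ z _ _ (esym (pdy_derive nu F)) (esym (pdx_derive mu F))
  (esym (pdx_derive mu (pdy nu F))) (esym (pdy_derive nu (pdx mu F))); apply.
- exact: (near_derivable 1).
- exact: (near_derivable 1).
- by apply: (near_derivable 0) => //; exact: class_C_pdy cF.
- by apply: (near_derivable 0) => //; exact: class_C_pdx cF.
- exact: (class_C_pdx 0 S (pdy nu F) mu (class_C_pdy 1 S F nu cF)) z Sz.
- exact: (class_C_pdy 0 S (pdx mu F) nu (class_C_pdx 1 S F mu cF)) z Sz.
Qed.

End Mixed.

(** Euler's theorem: differentiate [F x (t *: y) = t * F x y] in [t] at [t = 1]. *)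
Lemma euler_homogeneous S F x y : homogeneous 1 S F -> S (x, y) ->
  differentiable (F x) y -> \sum_mu y ord0 mu * pdy mu F x y = F x y.
Proof.
move=> hF Sxy dF; rewrite -derive_fibre //.
have H := @is_derive_along_line R (vec R n) (F x) 0 y 1.
rewrite scale1r add0r in H.
have {H} [_ <-] := H (diff_derivable dF).
(* Homogeneity covers only positive [t], which is enough for a derivative at [1]. *)
rewrite (near_eq_derive _ (g := fun t : R => t * F x y)).
  by rewrite deriveM //= derive_cst derive_id scaler0 add0r [LHS]mulr1.
near=> t; rewrite add0r (hF _ _ _ Sxy) ?expr1 //.
by near: t; apply: lt_nbhsr; exact: ltr01.
Unshelve. all: by end_near. Qed.

End Chart.

(** * Row spaces and kernels of matrices of known rank *)

Section LinearAlgebra.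
Variable K : fieldType.

(** The invertible minor forces the selected rows to have rank at least [k], the full rank of [A],
    so they already span its row space. *)
Lemma sub_rowsub_minor (p q k : nat) (A : 'M[K]_(p, q)) (f : 'I_k -> 'I_p) (g : 'I_k -> 'I_q) :
  mxsub f g A \in unitmx -> \rank A = k -> (A <= rowsub f A)%MS.
Proof.
move=> uA rA; have sub : (rowsub f A <= A)%MS by rewrite rowsub_sub.
rewrite -(mxrank_leqif_sup sub).2 eqn_leq mxrankS //= rA.
apply: (@leq_trans (\rank (mxsub f g A))); first by rewrite mxrank_unit.
have -> : mxsub f g A = rowsub f A *m colsub g 1%:M.
  by rewrite mulmx_colsub mulmx1; apply/matrixP => i j; rewrite !mxE.
exact: mxrankM_maxl.
Qed.

(** Dimension count: the rows of [B] are [k] independent vectors of a left kernel of dimension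
    [k]. *)
Lemma kermx_sub_row_free (k p q : nat) (A : 'M[K]_(p, q)) (B : 'M[K]_(k, p)) :
  row_free B -> B *m A = 0 -> (p - \rank A)%N = k -> (kermx A <= B)%MS.
Proof.
move=> /eqP rB BA pE; have sub : (B <= kermx A)%MS by exact/sub_kermxP.
by rewrite -(mxrank_leqif_sup sub).2 mxrank_ker rB pE.
Qed.
End LinearAlgebra.

(** * Rules for derivatives in the fibre coordinates *)

Section FibreDerivatives.
Context {R : realType} {n : nat}.
Implicit Types (F : vec R n -> vec R n -> R) (S : set (vec R n * vec R n))
  (x y : vec R n) (mu nu alpha : 'I_n.+1).

(** A derivative depends only on values nearby, so an identity known on an open domain alone may
    still be differentiated in [dx]. *)
Lemma eq_pdy S F (G : vec R n -> vec R n -> R) alpha x y : open S -> S (x, y) ->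
  (forall x y, S (x, y) -> F x y = G x y) -> pdy alpha F x y = pdy alpha G x y.
Proof.
move=> oS Sxy FG; apply: near_eq_derive.
by apply: filterS (near_fibre S x y oS Sxy) => y'; exact: FG.
Qed.

Lemma pdy_contraction (A B : 'I_n.+1 -> vec R n -> vec R n -> R) alpha x y :
  (forall mu, differentiable (A mu x) y) -> (forall mu, differentiable (B mu x) y) ->
  pdy alpha (fun x y => \sum_mu A mu x y * B mu x y) x y =
  \sum_mu (A mu x y * pdy alpha (B mu) x y + B mu x y * pdy alpha (A mu) x y).
Proof.
move=> dA dB; rewrite /pdy.
rewrite (_ : (fun y' => _) = \sum_mu (A mu x * B mu x)); last first.
  by apply/funext => y'; rewrite fct_sumE.
rewrite derive_sum; last by move=> mu; apply: derivableM; exact: diff_derivable.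
by apply: eq_bigr => mu _; rewrite deriveM //; exact: diff_derivable.
Qed.

Lemma pdy_coord mu alpha x y :
  pdy alpha (fun _ y : vec R n => y ord0 mu) x y = (mu == alpha)%:R.
Proof.
have := @derive_mx R (vec R n) 1 n.+1 id y (delta_mx ord0 alpha).
rewrite derive_id => /(_ (@derivable_id _ _ _ _)) /(congr1 (fun A : vec R n => A ord0 mu)).
by rewrite !mxE eqxx /= => ->.
Qed.

Lemma differentiable_sum_prod (A B : 'I_n.+1 -> vec R n -> R) y :
  (forall mu, differentiable (A mu) y) -> (forall mu, differentiable (B mu) y) ->
  differentiable (fun y => \sum_mu A mu y * B mu y) y.
Proof.
move=> dA dB; rewrite (_ : (fun y' => _) = \sum_mu (A mu * B mu)); last first.
  by apply/funext => y'; rewrite fct_sumE.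
by apply: differentiable_sum => mu; exact: differentiableM.
Qed.
End FibreDerivatives.

(** * Finsler metrics and connections *)

Section SingularFinsler.
Context {R : realType} {D m : nat}.
Variables (DL : set (vec R (D + m) * vec R (D + m))) (L : vec R (D + m) -> vec R (D + m) -> R).
Hypotheses (hL : finsler_metric DL L).
Local Notation n := (D + m)%N.
Implicit Types (x y w : vec R n) (mu nu alpha beta : 'I_n.+1).

Let oDL : open DL := finsler_open hL.
Let C2 : class_C 2 DL L := finsler_regular hL.
Let C1y mu : class_C 1 DL (pdy mu L) := class_C_pdy 1 DL L mu C2.
Let C1x mu : class_C 1 DL (pdx mu L) := class_C_pdx 1 DL L mu C2.

Let dif k F x y : class_C k.+1 DL F -> DL (x, y) -> differentiable (F x) y.
Proof. by move=> cF Sxy; apply: differentiable_fibre; exact: class_C_differentiable cF Sxy. Qed.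

Lemma momentum_velocity x y : DL (x, y) -> \sum_mu y ord0 mu * pdy mu L x y = L x y.
Proof.
by move=> Sxy; apply: (euler_homogeneous DL) (finsler_homogeneous hL) (Sxy) (dif _ _ _ _ C2 Sxy).
Qed.

Lemma hess_sym x y mu nu : DL (x, y) -> hess L x y mu nu = hess L x y nu mu.
Proof. by move=> Sxy; rewrite !mxE; exact: (pdy_pdyC _ _ oDL C2 mu nu (x, y)). Qed.

(** Differentiating [p.y = L] along the fibre gives [p_mu] plus the stated sum on the left and
    [p_mu] on the right. *)
Lemma hess_velocity x y mu : DL (x, y) -> \sum_nu hess L x y mu nu * y ord0 nu = 0.
Proof.
move=> Sxy; have := eq_pdy _ _ _ mu x y oDL Sxy momentum_velocity.
rewrite (pdy_contraction (fun nu _ y => y ord0 nu)); last 2 first.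
- by move=> nu; exact: differentiable_coord.
- by move=> nu; exact: dif _ _ _ _ (C1y nu) Sxy.
rewrite big_split /= [X in _ + X](bigD1 mu) //= [X in _ + (_ + X)]big1; last first.
  by move=> nu nm; rewrite pdy_coord (negbTE nm) mulr0.
rewrite pdy_coord eqxx mulr1 addr0 => /eqP; rewrite -subr_eq0 addrK => /eqP E; rewrite -[RHS]E.
by apply: eq_bigr => nu _; rewrite mxE mulrC.
Qed.

Section Connection.
Variables (N : 'I_n.+1 -> 'I_n.+1 -> vec R n -> vec R n -> R)
  (S : set (vec R n * vec R n)).
Hypothesis hN : finsler_connection DL S L N.

Lemma differentiable_auxG x y mu : DL (x, y) -> differentiable (fun y => auxG N x y mu) y.
Proof.
move=> Sxy; apply: differentiableM => //.
apply: differentiable_sum_prod => alpha.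
- exact: connection_differentiable hN mu alpha x y Sxy.
- exact: differentiable_coord.
Qed.

(** The derivative is half of [N mu beta] plus half of the contraction of [y] with
    [pdy beta (N mu alpha)]. Symmetry of the connection swaps [alpha] and [beta], and Euler's
    theorem turns that contraction into [N mu beta] again. *)
Lemma pdy_auxG x y mu beta : DL (x, y) ->
  pdy beta (fun x y => auxG N x y mu) x y = N mu beta x y.
Proof.
move=> Sxy; rewrite /pdy /auxG.
have dN alpha : differentiable (N mu alpha x) y.
  exact: connection_differentiable hN mu alpha x y Sxy.
rewrite (@deriveMl R (vec R n) (fun y => \sum_alpha N mu alpha x y * y ord0 alpha)); last first.
  apply: diff_derivable; apply: differentiable_sum_prod => alpha //.
  exact: differentiable_coord.
rewrite -/(pdy beta (fun x y => \sum_alpha N mu alpha x y * y ord0 alpha) x y).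
rewrite (pdy_contraction _ (fun alpha _ y => y ord0 alpha)) //; last first.
  by move=> alpha; exact: differentiable_coord.
rewrite big_split /= (bigD1 beta) //= [X in _ + X + _]big1; last first.
  by move=> nu nm; rewrite pdy_coord (negbTE nm) mulr0.
rewrite pdy_coord eqxx mulr1 addr0.
rewrite (eq_bigr (fun alpha => y ord0 alpha * pdy alpha (N mu beta) x y)); last first.
  by move=> alpha _; rewrite (connection_symmetric hN).
rewrite (euler_homogeneous DL) //; last exact: connection_homogeneous hN mu beta.
by field.
Qed.

(** The identity for [p.G] is assumed on all of [DL] because it is differentiated; the relation
    [dL/dx = p N] is used only at the point itself, hence the membership in [S]. Differentiation
    yields [dL/dx + H G] on the left and half of [dL/dx] plus the mixed term of [Mcov] on the
    right. *)
Lemma hess_auxG x y alpha : DL (x, y) -> S (x, y) ->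
  (forall x y, DL (x, y) -> \sum_mu pdy mu L x y * auxG N x y mu =
     2^-1 * \sum_beta y ord0 beta * pdx beta L x y) ->
  \sum_mu hess L x y alpha mu * auxG N x y mu = Mcov L x y alpha.
Proof.
move=> Dxy Sxy pG; have := eq_pdy _ _ _ alpha x y oDL Dxy pG.
rewrite (pdy_contraction _ (fun mu x y => auxG N x y mu)); last 2 first.
- by move=> mu; exact: dif _ _ _ _ (C1y mu) Dxy.
- by move=> mu; exact: differentiable_auxG.
rewrite /pdy (@deriveMl R (vec R n) (fun y => \sum_beta y ord0 beta * pdx beta L x y)); last first.
  apply: diff_derivable; apply: differentiable_sum_prod => beta.
  - exact: differentiable_coord.
  - exact: dif _ _ _ _ (C1x beta) Dxy.
rewrite -/(pdy alpha (fun x y => \sum_beta y ord0 beta * pdx beta L x y) x y).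
rewrite (pdy_contraction (fun beta _ y => y ord0 beta)); last 2 first.
- by move=> beta; exact: differentiable_coord.
- by move=> beta; exact: dif _ _ _ _ (C1x beta) Dxy.
rewrite !big_split /=.
rewrite (eq_bigr (fun mu => pdy mu L x y * N mu alpha x y)); last first.
  by move=> mu _; congr (_ * _); exact: pdy_auxG.
rewrite -(connection_metric hN alpha Dxy Sxy).
rewrite [X in _ * (_ + X)](bigD1 alpha) //= [X in _ * (_ + (_ + X))]big1; last first.
  by move=> nu nm; rewrite -/(pdy _ _ x y) pdy_coord (negbTE nm) mulr0.
rewrite -/(pdy alpha (fun _ y => y ord0 alpha) x y) pdy_coord eqxx mulr1 addr0.
have half_sub (a b c : R) : a + b = 2^-1 * (c + a) -> b = 2^-1 * (- a + c) by lra.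
move=> /half_sub E; rewrite -[RHS]E.
by apply: eq_bigr => mu _; rewrite mxE mulrC.
Qed.

End Connection.
End SingularFinsler.

(** * Pointwise equivalence of the two systems of equations *)

Section AutoParallel.
Context {R : realType} {D m : nat}.
Variables (DL : set (vec R (D + m) * vec R (D + m))) (L : vec R (D + m) -> vec R (D + m) -> R)
  (v : 'I_D -> vec R (D + m) -> vec R (D + m) -> vec R (D + m))
  (kappa : 'I_D -> vec R (D + m) -> vec R (D + m) -> R).
Local Notation n := (D + m)%N.
Implicit Types (x y w : vec R n) (mu nu alpha beta : 'I_n.+1).
Hypotheses (hL : finsler_metric DL L) (hL0 : forall x y, DL (x, y) -> L x y != 0)
  (hrank : forall x y, DL (x, y) -> \rank (hess L x y) = m)
  (hdet : forall x y, DL (x, y) -> \det (hess_ab L x y) != 0)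
  (hv : zero_eigenvectors DL L v).

Lemma sum_multiple_eq0 (c : R) (f g : 'I_n.+1 -> R) :
  \sum_mu f mu = 0 -> (forall mu, g mu = c * f mu) -> \sum_mu g mu = 0.
Proof. by move=> f0 gE; under eq_bigr do rewrite gE; rewrite -mulr_sumr f0 mulr0. Qed.

(** Used for two covectors: the momentum, where [p.y = L] makes the result zero, and a row of the
    Hessian, where [H y = 0] leaves the single entry [q (idxa D a)]. *)
Lemma contract_ella (q : 'I_n.+1 -> R) x y (a : 'I_m) :
  \sum_mu q mu * ella L x y a mu =
    q (idxa D a) - pdy (idxa D a) L x y / L x y * \sum_mu q mu * y ord0 mu.
Proof.
under eq_bigr do rewrite /ella mulrBr.
rewrite sumrB (bigD1 (idxa D a)) //= eqxx mulr1 big1 ?addr0; last first.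
  by move=> mu /negbTE ->; rewrite mulr0.
by rewrite mulr_sumr; congr (_ - _); apply: eq_bigr => mu _; ring.
Qed.

(** The momentum and every row of the Hessian annihilate the [v i], so the arbitrary [kappa] drops
    out of both contractions. *)
Lemma contract_explicitG (q : 'I_n.+1 -> R) x y :
  (forall i, \sum_mu q mu * v i x y ord0 mu = 0) ->
  \sum_mu q mu * explicitG L v kappa x y mu =
    2^-1 * (\sum_beta y ord0 beta * pdx beta L x y) * (\sum_mu q mu * y ord0 mu / L x y) +
    \sum_(a < m) \sum_(b < m) hess_inv L x y a b * Mcov L x y (idxa D b) *
      \sum_mu q mu * ella L x y a mu.
Proof.
move=> qv; rewrite /explicitG /ell0.
under eq_bigr do rewrite !mulrDr.
rewrite !big_split /= [X in _ + X + _](_ : _ = 0) ?addr0; last first.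
  under eq_bigr do rewrite mulr_sumr.
  rewrite exchange_big /= big1 // => i _.
  by apply: (sum_multiple_eq0 (kappa i x y) _ _ (qv i)) => mu; ring.
congr (_ + _).
  by rewrite [RHS]mulr_sumr; apply: eq_bigr => mu _; ring.
under eq_bigr do rewrite mulr_sumr.
rewrite exchange_big /=; apply: eq_bigr => a _.
under eq_bigr do rewrite mulr_sumr.
rewrite exchange_big /=; apply: eq_bigr => b _.
by rewrite mulr_sumr; apply: eq_bigr => mu _; ring.
Qed.

(** The momentum pairs to one with [ell0] and to zero with each [v i] and each [ella]. *)
Lemma momentum_explicitG x y : DL (x, y) ->
  \sum_mu pdy mu L x y * explicitG L v kappa x y mu =
    2^-1 * \sum_beta y ord0 beta * pdx beta L x y.
Proof.
move=> Dxy; rewrite contract_explicitG; last by move=> i; exact: (zero_momentum hv i Dxy).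
have py : \sum_mu pdy mu L x y * y ord0 mu = L x y.
  rewrite -[RHS](momentum_velocity _ _ hL x y Dxy).
  by apply: eq_bigr => mu _; rewrite mulrC.
rewrite -mulr_suml py divff ?hL0 // mulr1 [X in _ + X]big1 ?addr0 // => a _.
rewrite big1 // => b _; rewrite contract_ella py divfK ?hL0 // subrr mulr0 //.
Qed.

(** Only the [ella] part survives, since [dx] and the [v i] lie in the kernel of the Hessian. For
    [alpha = idxI m i] the right side is the term subtracted in [constraint]. *)
Lemma hess_explicitG x y alpha : DL (x, y) ->
  \sum_mu hess L x y alpha mu * explicitG L v kappa x y mu =
    \sum_(a < m) \sum_(b < m)
      hess L x y alpha (idxa D a) * hess_inv L x y a b * Mcov L x y (idxa D b).
Proof.
move=> Dxy; rewrite contract_explicitG; last by move=> i; exact: (zero_hess hv i alpha Dxy).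
have hy := hess_velocity _ _ hL x y alpha Dxy.
rewrite -mulr_suml hy mul0r mulr0 add0r.
apply: eq_bigr => a _; apply: eq_bigr => b _.
by rewrite contract_ella hy; ring.
Qed.

Lemma hess_explicitG_idxa x y (c : 'I_m) : DL (x, y) ->
  \sum_mu hess L x y (idxa D c) mu * explicitG L v kappa x y mu = Mcov L x y (idxa D c).
Proof.
move=> Dxy; rewrite hess_explicitG // exchange_big /=.
have uH : hess_ab L x y \in unitmx by rewrite unitmxE unitfE hdet.
have E b : \sum_a hess L x y (idxa D c) (idxa D a) * hess_inv L x y a b = (c == b)%:R.
  have := congr1 (fun A : 'M[R]_m => A c b) (mulmxV uH).
  rewrite !mxE => <-; apply: eq_bigr => a _; by rewrite /hess_ab !mxE.
under eq_bigr do rewrite -mulr_suml E.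
rewrite (bigD1 c) //= eqxx mul1r big1 ?addr0 // => b /negbTE.
by rewrite eq_sym => ->; rewrite mul0r.
Qed.

Definition hess_kernel x y (w : 'I_n.+1 -> R) :=
  forall alpha, \sum_mu hess L x y alpha mu * w mu = 0.

Lemma hess_kernel_span x y (l0 : R) (l : 'I_D -> R) (w : 'I_n.+1 -> R) : DL (x, y) ->
  (forall mu, w mu = l0 * ell0 L x y mu + \sum_i l i * v i x y ord0 mu) ->
  hess_kernel x y w.
Proof.
move=> Dxy wE alpha; under eq_bigr do rewrite wE mulrDr mulr_sumr.
rewrite big_split /= [X in X + _](_ : _ = 0) ?add0r; last first.
  apply: (sum_multiple_eq0 (l0 / L x y) _ _ (hess_velocity _ _ hL x y alpha Dxy)) => mu.
  by rewrite /ell0; ring.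
rewrite exchange_big big1 //= => i _.
by apply: (sum_multiple_eq0 (l i) _ _ (zero_hess hv i alpha Dxy)) => mu; ring.
Qed.

(** The block [hess_ab] is an invertible minor of full rank [m], so every row of the Hessian is a
    combination of the rows [idxa D a]. *)
Lemma hess_kernel_rows x y (w : 'I_n.+1 -> R) : DL (x, y) ->
  (forall a : 'I_m, \sum_mu hess L x y (idxa D a) mu * w mu = 0) -> hess_kernel x y w.
Proof.
move=> Dxy wa alpha; pose wc : 'cV[R]_n.+1 := \col_mu w mu.
have uH : mxsub (@idxa D m) (@idxa D m) (hess L x y) \in unitmx.
  have -> : mxsub (@idxa D m) (@idxa D m) (hess L x y) = hess_ab L x y.
    by apply/matrixP => i j; rewrite !mxE.
  by rewrite unitmxE unitfE hdet.
have /submxP[X HX] := sub_rowsub_minor _ _ _ _ _ _ _ uH (hrank x y Dxy).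
have w0 : rowsub (@idxa D m) (hess L x y) *m wc = 0.
  apply/colP => a; rewrite [RHS]mxE -(wa a) mxE; apply: eq_bigr => mu _.
  by rewrite mxE [wc _ _]mxE.
have : hess L x y *m wc = 0 by rewrite HX -mulmxA w0 mulmx0.
move=> /colP /(_ alpha); rewrite [RHS]mxE => E; rewrite -[RHS]E mxE.
by apply: eq_bigr => mu _; rewrite [wc _ _]mxE.
Qed.

(** The vectors [ell0] and [v i] form [1 + D] independent rows of a kernel of exactly that
    dimension, hence a basis of it. *)
Lemma span_hess_kernel x y (w : 'I_n.+1 -> R) : DL (x, y) -> hess_kernel x y w ->
  exists (l0 : R) (l : 'I_D -> R),
    forall mu, w mu = l0 * ell0 L x y mu + \sum_i l i * v i x y ord0 mu.
Proof.
move=> Dxy wk.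
pose V : 'M[R]_(D, n.+1) := \matrix_(i < D) v i x y.
pose B : 'M[R]_(1 + D, n.+1) := col_mx ((L x y)^-1 *: y) V.
pose H := hess L x y.
have BE (u : 'rV[R]_1) (t : 'rV[R]_D) mu : (row_mx u t *m B) ord0 mu =
    u ord0 ord0 * ell0 L x y mu + \sum_i t ord0 i * v i x y ord0 mu.
  rewrite mul_row_col mxE; congr (_ + _).
    by rewrite mxE big_ord1 mxE /ell0 [_^-1 * _]mulrC.
  by rewrite mxE; apply: eq_bigr => i _; rewrite mxE.
have freeB : row_free B.
  rewrite -kermx_eq0; apply/rowV0P => X /sub_kermxP; rewrite -[X]hsubmxK.
  set u := lsubmx X; set t := rsubmx X => XB.
  (* Pairing a vanishing combination with the momentum isolates the coefficient of [ell0], because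
     [p.ell0 = 1] and [p.v = 0]. *)
  have u0 : u = 0.
    apply/rowP => j; rewrite ord1 [RHS]mxE.
    have := sum_multiple_eq0 0 (fun=> 0) (fun mu => pdy mu L x y * (row_mx u t *m B) ord0 mu).
    rewrite big1 // => /(_ erefl) H0.
    have {}H0 : \sum_mu pdy mu L x y * (row_mx u t *m B) ord0 mu = 0.
      by apply: H0 => mu; rewrite XB mxE !mulr0.
    move: H0; rewrite (eq_bigr (fun mu => u ord0 ord0 / L x y * (y ord0 mu * pdy mu L x y) +
      \sum_i t ord0 i * (pdy mu L x y * v i x y ord0 mu))); last first.
      move=> mu _; rewrite BE mulrDr mulr_sumr; congr (_ + _); first by rewrite /ell0; ring.
      by apply: eq_bigr => i _; ring.
    rewrite big_split /= -mulr_sumr (momentum_velocity _ _ hL) // divfK ?hL0 //.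
    rewrite exchange_big /= [X in _ + X]big1 ?addr0 // => i _.
    by rewrite -mulr_sumr (zero_momentum hv i Dxy) mulr0.
  have t0 : t = 0.
    move: XB; rewrite u0 mul_row_col mul0mx add0r.
    have /row_freeP[W VW] := zero_free hv Dxy.
    by move/(congr1 (mulmx^~ W)); rewrite mul0mx -mulmxA VW mulmx1.
  by rewrite u0 t0 row_mx0.
(* The transpose appears because vectors are rows here and [kermx] is a left kernel. *)
have BH : B *m H^T = 0.
  apply/matrixP => i alpha; rewrite [RHS]mxE.
  have Bi : row i B = row_mx (lsubmx (delta_mx ord0 i)) (rsubmx (delta_mx ord0 i)) *m B.
    by rewrite hsubmxK rowE.
  have k0 := hess_kernel_span x y _ _ _ Dxy (fun mu => BE (lsubmx (delta_mx ord0 i)) (rsubmx (delta_mx ord0 i)) mu) alpha.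
  rewrite -[RHS]k0 -Bi mxE; apply: eq_bigr => mu _.
  by rewrite [H^T _ _]mxE [row i B _ _]mxE mulrC.
have kB : (kermx H^T <= B)%MS.
  (* The count is [(D + m).+1 - m = 1 + D]. *)
  apply: kermx_sub_row_free => //; rewrite mxrank_tr hrank //.
  by rewrite subSn ?leq_addl // addnK.
have /submxP[X wX] : ((\row_mu w mu : 'rV[R]_n.+1) <= B)%MS.
  apply: submx_trans kB; apply/sub_kermxP; apply/rowP => alpha.
  rewrite [RHS]mxE -(wk alpha) mxE; apply: eq_bigr => mu _.
  by rewrite mxE [H^T _ _]mxE mulrC.
exists (lsubmx X ord0 ord0), (fun i => rsubmx X ord0 i) => mu.
by rewrite -BE hsubmxK -wX mxE.
Qed.

(** Symmetry of the second derivatives brings the Euler-Lagrange expression to the form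
    [- 2 M - H a], linear in an acceleration [a] that is left free. *)
Lemma el_pointwise x y (a : 'I_n.+1 -> R) alpha : DL (x, y) ->
  pdx alpha L x y
    - \sum_beta pdx beta (pdy alpha L) x y * y ord0 beta
    - \sum_beta pdy beta (pdy alpha L) x y * a beta
  = - (2 * Mcov L x y alpha) - \sum_mu hess L x y alpha mu * a mu.
Proof.
move=> Dxy; congr (_ - _); last first.
  by apply: eq_bigr => mu _; rewrite (hess_sym _ _ hL) // mxE.
rewrite /Mcov mulrA divff ?pnatr_eq0 // mul1r opprD opprK; congr (_ - _).
apply: eq_bigr => rho _; rewrite [LHS]mulrC.
exact: congr1 (pdx_pdyC _ _ (finsler_open hL) (finsler_regular hL) rho alpha (x, y) Dxy).
Qed.

Variable N : 'I_n.+1 -> 'I_n.+1 -> vec R n -> vec R n -> R.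
Hypotheses
  (hN : finsler_connection DL [set z | forall i, constraint L z.1 z.2 i = 0] L N)
  (hG : forall x y mu, DL (x, y) -> auxG N x y mu = explicitG L v kappa x y mu).

Lemma el_pointwise_iff x y (a : 'I_n.+1 -> R) : DL (x, y) ->
  (forall alpha, - (2 * Mcov L x y alpha) - \sum_mu hess L x y alpha mu * a mu = 0) <->
  (exists (l0 : R) (l : 'I_D -> R), forall mu,
     a mu + 2 * auxG N x y mu = l0 * ell0 L x y mu + \sum_i l i * v i x y ord0 mu) /\
  (forall i, constraint L x y i = 0).
Proof.
move=> Dxy.
have sumD alpha : \sum_mu hess L x y alpha mu * (a mu + 2 * auxG N x y mu) =
    \sum_mu hess L x y alpha mu * a mu
    + 2 * \sum_mu hess L x y alpha mu * explicitG L v kappa x y mu.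
  rewrite mulr_sumr -big_split /=; apply: eq_bigr => mu _.
  by rewrite hG //; ring.
have half_eq (s t M : R) : - (2 * M) - s = 0 -> s + 2 * t = 0 -> t = M by move=> *; lra.
split=> [EL|[[l0 [l lE]] C0]].
- have wk : hess_kernel x y (fun mu => a mu + 2 * auxG N x y mu).
    (* Only the equations with index [idxa D c] are used here, where [(H G)_c = M_c] needs no
       constraint. *)
    apply: hess_kernel_rows => // c; rewrite sumD hess_explicitG_idxa //.
    by have := EL (idxa D c); move: (\sum_mu _) (Mcov _ _ _ _) => s M; lra.
  split; first exact: span_hess_kernel.
  (* With the kernel condition known, the equation of index [idxI m i] forces [(H G)_i = M_i], which
     is the constraint. *)
  move=> i; apply/eqP; rewrite /constraint -hess_explicitG // subr_eq0 eq_sym; apply/eqP.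
  by apply: half_eq (EL (idxI m i)) _; rewrite -sumD.
- move=> alpha; have := hess_kernel_span x y l0 l _ Dxy lE alpha; rewrite sumD.
  (* [C0] places the point in the set where the connection satisfies [dL/dx = p N]; this gives
     [H G = M] for every index, [0] included. *)
  have := hess_auxG _ _ hL N _ hN x y alpha Dxy C0.
  rewrite (eq_bigr (fun mu => hess L x y alpha mu * explicitG L v kappa x y mu)); last first.
    by move=> mu _; rewrite hG.
  move=> ->; last first.
    move=> x' y' Dxy'; rewrite -momentum_explicitG //.
    by apply: eq_bigr => mu _; rewrite hG.
  by move: (\sum_mu _) (Mcov _ _ _ _) => s M; lra.
Qed.
End AutoParallel.

(** * Curves *)

Section Curves.
Context {R : realType} {n : nat}.
Variables (DL : set (vec R n * vec R n)) (J : set R) (c : R -> vec R n).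
Hypothesis hc : parameterised_curve DL J c.

(** Chain rule for the lift of [c] to the tangent bundle, whose own derivative is the pair of
    velocity and acceleration. *)
Lemma derive1_lift (F : vec R n -> vec R n -> R) t : J t ->
  differentiable (fun z => F z.1 z.2) (c t, derive1 c t) ->
  derive1 (fun s => F (c s) (derive1 c s)) t =
    \sum_mu derive1 c t ord0 mu * pdx mu F (c t) (derive1 c t) +
    \sum_mu derive1 (derive1 c) t ord0 mu * pdy mu F (c t) (derive1 c t).
Proof.
move=> Jt dF.
have dc : differentiable c t by exact/derivable1_diffP/(curve_derivable hc).
have dc' : differentiable (derive1 c) t by exact/derivable1_diffP/(curve_derivable2 hc).
have dp : differentiable (fun s => (c s, derive1 c s)) t by exact: differentiable_pair.
have -> : (fun s => F (c s) (derive1 c s))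
    = (fun z : vec R n * vec R n => F z.1 z.2) \o (fun s => (c s, derive1 c s)) by [].
rewrite derive1E'; last exact: differentiable_comp.
have E1 := congr1 (fun h : R -> R => h 1) (diff_comp dp dF).
have E2 : 'd (fun s => (c s, derive1 c s)) t 1 = (derive1 c t, derive1 (derive1 c) t).
  rewrite (derive1E' dc) (derive1E' dc').
  exact: (congr1 (fun h : R -> vec R n * vec R n => h 1) (diff_pair dc dc')).
apply: (etrans E1); rewrite /= E2.
exact: diff_partials.
Qed.

(** Prescribe [l ^+ k * r t] at [(c t, l *: derive1 c t)] for [l > 0], and zero off these rays.
    Injectivity recovers [t] from the base point and the nonzero velocity recovers [l], so the value
    is unambiguous. *)
Lemma homogeneous_extension (k : nat) (I : set R) (r : R -> R) : I `<=` J ->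
  (forall t, J t -> derive1 c t != 0) -> {in I &, injective c} ->
  exists F : vec R n -> vec R n -> R, homogeneous k DL F /\
    forall t, I t -> F (c t) (derive1 c t) = r t.
Proof.
move=> IJ c0 ci.
(* [P x y] collects the values prescribed at [(x, y)]: at most one by [P1], none off the rays, where
   [xget] returns its default [0]. *)
pose P x y := [set s : R | exists t l : R,
  [/\ I t, 0 < l, x = c t, y = l *: derive1 c t & s = l ^+ k * r t]].
have P1 x y : is_subset1 (P x y).
  move=> _ _ [t [l [It l0 -> -> ->]]] [t' [l' [It' l'0 ctt' ll' ->]]].
  have tt' : t = t' by apply: ci; rewrite ?inE.
  move: ll'; rewrite -tt' => /eqP; rewrite -subr_eq0 -scalerBl scaler_eq0.
  by rewrite (negbTE (c0 t (IJ _ It))) orbF subr_eq0 => /eqP ->.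
have PZ x y l s : 0 < l -> P x y s -> P x (l *: y) (l ^+ k * s).
  move=> l0 [t [l' [It l'0 -> -> ->]]]; exists t, (l * l').
  by rewrite mulr_gt0 // scalerA exprMn mulrA.
exists (fun x y => xget 0 (P x y)); split; last first.
  move=> t It; apply: (xget_subset1 0 _ (P1 _ _)).
  by exists t, 1; rewrite scale1r expr1n mul1r.
move=> x y l _ l0.
case: (pselect (exists s, P x y s)) => [[s Ps]|nP].
  by rewrite (xget_subset1 0 (PZ _ _ _ _ l0 Ps) (P1 _ _)) (xget_subset1 0 Ps (P1 _ _)).
(* Off the rays both sides are the default: a value prescribed at [l *: y] would, rescaled by
   [l^-1], give one at [y]. *)
rewrite !xgetPN ?mulr0 //.
- by move=> s Ps; apply: nP; exists s.
- move=> s Ps; apply: nP; exists (l^-1 ^+ k * s).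
  have := PZ _ _ l^-1 _ _ Ps; rewrite scalerA mulVf ?gt_eqF // scale1r; apply.
  by rewrite invr_gt0.
Qed.

(** Some coordinate has nonzero derivative at [t0], and by continuity nearby. Equal positions at two
    nearby times would, by the mean value theorem, make that derivative vanish in between. *)
Lemma locally_injective_curve t0 : J t0 -> derive1 c t0 != 0 ->
  exists2 e : R, 0 < e & {in J `&` ball t0 e &, injective c}.
Proof.
move=> Jt0 /rV0Pn[mu cmu].
pose g s := c s ord0 mu; pose dg s := derive1 c s ord0 mu.
have gd s : J s -> is_derive s (1 : R) g (dg s).
  move=> Js; have dc := curve_derivable hc Js; split.
    by move/derivable_mxP : dc; apply.
  by rewrite /dg derive1E derive_mx // mxE.
have cdg : {for t0, continuous dg}.
  apply/differentiable_continuous/derivable1_diffP.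
  by move/derivable_mxP : (curve_derivable2 hc Jt0); apply.
have nz : \forall s \near t0, dg s != 0.
  by apply: (cdg [set r | r != 0]); apply: open_nbhs_nbhs; split => //; exact: open_neq.
have nJ : \forall s \near t0, J s.
  by apply: open_nbhs_nbhs; split => //; exact: curve_open hc.
have [e /= e0 eP] := (nbhs_ballP _ _).1 (filterI nJ nz).
exists e => //.
have lt_neq s t : ball t0 e s -> ball t0 e t -> s < t -> c s <> c t.
  move=> bs bt st cst.
  have bI u : s <= u <= t -> ball t0 e u.
    move: bs bt; rewrite -!ball_normE /= !ltr_norml => /andP[? ?] /andP[? ?] /andP[? ?].
    by apply/andP; split; lra.
  have [u||u /[!in_itv] /= /andP[su ut]] := @MVT R g dg s t st.
  - rewrite in_itv /= => /andP[su ut]; apply: gd.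
    by have [] := eP u (bI u _); rewrite ?ltW.
  - apply: derivable_within_continuous => u; rewrite in_itv /= => sut.
    by have [] := gd u (eP u (bI u sut)).1.
  - rewrite /g cst subrr => /esym/eqP; rewrite mulf_eq0 subr_eq0 (gt_eqF st) orbF.
    by apply/negP; have [] := eP u (bI u _); rewrite ?ltW.
move=> s t; rewrite !inE => -[_ bs] [_ bt] cst.
by have [st|ts|//] := ltgtP s t; [case: (lt_neq s t)|case: (lt_neq t s)].
Qed.
End Curves.

(** * The equivalence along a curve *)

Lemma finsler_velocity_neq0 (R : realType) (n : nat) (DL : set (vec R n * vec R n))
    (L : vec R n -> vec R n -> R) x y :
  finsler_metric DL L -> L x y != 0 -> DL (x, y) -> y != 0.
Proof.
move=> hL Lxy Dxy; apply: contraNneq Lxy => y0.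
(* At [y = 0] scaling by two gives [L x 0 = 2 * L x 0], so [L] would vanish there. *)
have := finsler_homogeneous hL Dxy (ltr0n R 2).
by rewrite y0 scaler0 expr1; move: (L x 0) => l E; apply/eqP; lra.
Qed.

Theorem mainTheorem5 (R : realType) (D m : nat)
  (DL : set (vec R (D + m) * vec R (D + m)))
  (L : vec R (D + m) -> vec R (D + m) -> R)
  (v : 'I_D -> vec R (D + m) -> vec R (D + m) -> vec R (D + m))
  (kappa : 'I_D -> vec R (D + m) -> vec R (D + m) -> R)
  (N : 'I_(D + m).+1 -> 'I_(D + m).+1 -> vec R (D + m) -> vec R (D + m) -> R)
  (hD : (0 < D)%N)
  (hL : finsler_metric DL L)
  (hL0 : forall x y, DL (x, y) -> L x y != 0)
  (hrank : forall x y, DL (x, y) -> \rank (hess L x y) = m)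
  (hdet : forall x y, DL (x, y) -> \det (hess_ab L x y) != 0)
  (hv : zero_eigenvectors DL L v)
  (hN : finsler_connection DL [set z | forall i, constraint L z.1 z.2 i = 0] L N)
  (hG : forall x y mu, DL (x, y) -> auxG N x y mu = explicitG L v kappa x y mu)
  (J : set R) (c : R -> vec R (D + m))
  (hc : parameterised_curve DL J c) :
  [/\ (forall t alpha, J t -> el_total L c t alpha = el_expanded L c t alpha),
      (euler_lagrange L J c <-> locally_auto_parallel DL L v (auxG N) J c) &
      ({in J &, injective c} ->
        (euler_lagrange L J c <-> auto_parallel DL L v (auxG N) J c))].
Proof.
have C2 := finsler_regular hL.
have vel t : J t -> DL (c t, derive1 c t) by move=> Jt; exact: (curve_velocity hc Jt).
have total t alpha : J t -> el_total L c t alpha = el_expanded L c t alpha.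
  move=> Jt; rewrite /el_total /el_expanded (derive1_lift _ _ _ hc) //; last first.
    by apply: (class_C_differentiable 0 DL) (vel t Jt); exact: class_C_pdy.
  rewrite opprD addrA; congr (_ - _ - _); apply: eq_bigr => beta _; exact: mulrC.
pose EL t := forall alpha, - (2 * Mcov L (c t) (derive1 c t) alpha)
  - \sum_mu hess L (c t) (derive1 c t) alpha mu * derive1 (derive1 c) t ord0 mu = 0.
have EL_iff t : J t -> (forall alpha, 0 = el_total L c t alpha) <-> EL t.
  move=> Jt; have E alpha := etrans (total t alpha Jt)
    (el_pointwise _ _ hL _ _ (fun mu => derive1 (derive1 c) t ord0 mu) alpha (vel t Jt)).
  by split=> H alpha; [rewrite -E -H|rewrite E H].
have pointwise t (Jt : J t) := el_pointwise_iff DL L v kappa hL hL0 hrank hdet hv N hN hG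
  _ _ (fun mu => derive1 (derive1 c) t ord0 mu) (vel t Jt).
(* Stated for a subset [I] so as to serve twice: with a small neighbourhood for the local claim, and
   with [J] itself when the whole curve is injective. *)
have to_parallel I : I `<=` J -> {in I &, injective c} -> (forall t, J t -> EL t) ->
    auto_parallel DL L v (auxG N) I c.
  move=> IJ ci el; split; last by move=> t i It; exact: ((pointwise t (IJ t It)).1 (el t (IJ t It))).2.
  have c0 t : J t -> derive1 c t != 0.
    by move=> Jt; apply: (finsler_velocity_neq0 _ _ _ _ _ _ hL (hL0 _ _ (vel t Jt)) (vel t Jt)).
  (* Multipliers are first chosen for each parameter value separately; outside [I] zero is an
     arbitrary filler. *)
  have /choice[r rP] : forall t, exists r : R * ('I_D -> R), I t -> forall mu,
      derive1 (derive1 c) t ord0 mu + 2 * auxG N (c t) (derive1 c t) mu =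
      r.1 * ell0 L (c t) (derive1 c t) mu + \sum_i r.2 i * v i (c t) (derive1 c t) ord0 mu.
    move=> t; have [It|nI] := pselect (I t); last by exists (0, fun=> 0).
    have [[l0 [l lE]] _] := (pointwise t (IJ t It)).1 (el t (IJ t It)).
    by exists (l0, l).
  (* The chosen functions of [t] become functions of [(x, dx)] of degree two. *)
  have ext (s : R -> R) := homogeneous_extension DL J c 2 I s IJ c0 ci.
  have [F0 [hF0 F0E]] := ext (fun t => (r t).1).
  have /choice[F FP] i := ext (fun t => (r t).2 i).
  exists F0, F; split=> // [i|t mu It]; first exact: (FP i).1.
  rewrite rP // F0E //; congr (_ + _); apply: eq_bigr => i _.
  by rewrite (FP i).2.
have of_parallel I t : I t -> J t -> auto_parallel DL L v (auxG N) I c ->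
    forall alpha, 0 = el_total L c t alpha.
  (* This direction only evaluates the multipliers on the curve, so neither their homogeneity nor
     injectivity enters. *)
  move=> It Jt [[l0 [l [_ _ lE]]] C0]; apply/(EL_iff t Jt)/(pointwise t Jt).
  split; last by move=> i; exact: C0.
  by exists (l0 (c t) (derive1 c t)), (fun i => l i (c t) (derive1 c t)) => mu; exact: lE.
split=> //.
- split=> [el t0 Jt0|ap t alpha Jt].
  + have c0 := finsler_velocity_neq0 _ _ _ _ _ _ hL (hL0 _ _ (vel _ Jt0)) (vel _ Jt0).
    have [e e0 ci] := locally_injective_curve _ _ _ hc t0 Jt0 c0.
    exists e => //; apply: to_parallel ci _; first by move=> ? [].
    by move=> t Jt; apply/(EL_iff t Jt) => alpha; exact: el.
  + have [e e0 apt] := ap t Jt; apply: (of_parallel _ t _ Jt apt).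
    by split=> //; exact: ballxx.
- move=> ci; split=> [el|ap t alpha Jt]; last exact: (of_parallel _ t Jt Jt ap).
  apply: to_parallel => // t Jt; apply/(EL_iff t Jt) => alpha; exact: el.
Qed.
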